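(* Let $f:A\to A$ be a reversible map of the closed annulus $A=\{z\in\mathbb{R}^2 : 1\le |z|\le 2\}$ which is isotopic to the identity and satisfies the boundary twist condition. Then on each of the two connected components of $\mathrm{Fix}\, I_A=\{(0,y) : 1\le |y|\le 2\}$ there is a symmetric fixed point of $f$ lying in the interior $\mathring A=\{z\in\mathbb{R}^2 : 1<|z|<2\}$.
   Context: Let $I:\mathbb{R}^2\to\mathbb{R}^2$, $I(x,y)=(-x,y)$, and $I_A:=I|_A$. A homeomorphism $f:A\to A$ is called a reversible map if $f\circ I_A=I_A\circ f^{-1}$ (no area preservation is assumed). Isotopic means isotopic through homeomorphisms. A symmetric fixed point of $f$ is a point $z$ with $f(z)=z=I_A(z)$. Let $S=\mathbb{R}\times[0,1]$ be the universal cover of $A$, with covering map $(x,y)\mapsto((1+y)\sin x,(1+y)\cos x)$. A homeomorphism $f:A\to A$ isotopic to the identity satisfies the boundary twist condition if it rotates the two boundary circles in opposite angular directions, precisely: there is a lift $F=(F_1,F_2):S\to S$ of $f$ such that $F_1(x,0)<x<F_1(x,1)$ for all $x\in\mathbb{R}$. *)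

(* Defs.v *)
From HB Require Import structures.
From mathcomp Require Import all_boot all_order all_algebra.
From mathcomp Require Import all_classical all_reals all_analysis.
Import Order.TTheory GRing.Theory Num.Theory.
Import numFieldNormedType.Exports.

Local Open Scope classical_set_scope.
Local Open Scope ring_scope.

(* The plane is the product space R * R; a map defined on a subset of the plane
   is an ambient function of which only the values on that subset matter, with
   continuity taken for the subspace topology. *)

(* The library norm of R * R is the sup norm, hence a separate Euclidean norm. *)
Definition enorm {R : realType} (z : R * R) : R :=
  Num.sqrt (z.1 ^+ 2 + z.2 ^+ 2).

Definition annulus (R : realType) : set (R * R) :=
  [set z | 1 <= enorm z <= 2].

Definition open_annulus (R : realType) : set (R * R) :=
  [set z | 1 < enorm z < 2].

Definition refl_I {R : realType} (z : R * R) : R * R := (- z.1, z.2).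

Definition fix_IA (R : realType) : set (R * R) :=
  [set z | annulus R z /\ refl_I z = z].

Definition inverse_homeos {T : topologicalType} (A : set T) (f g : T -> T) :=
  [/\ (forall z, A z -> A (f z)) /\ (forall z, A z -> A (g z)),
      forall z, A z -> g (f z) = z,
      forall z, A z -> f (g z) = z,
      {within A, continuous f} & {within A, continuous g}].

Definition homeomorphism {T : topologicalType} (A : set T) (f : T -> T) :=
  exists g, inverse_homeos A f g.

Definition isotopic (R : realType) {T : topologicalType} (A : set T)
    (f g : T -> T) :=
  exists H : R * T -> T,
    [/\ {within `[0, 1] `*` A, continuous H},
        forall t, 0 <= t <= 1 -> homeomorphism A (fun z => H (t, z)),
        forall z, A z -> H (0, z) = f z &
        forall z, A z -> H (1, z) = g z].

Definition reversible {R : realType} (f : R * R -> R * R) :=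
  exists g, inverse_homeos (annulus R) f g /\
    forall z, annulus R z -> f (refl_I z) = refl_I (g z).

Definition strip (R : realType) : set (R * R) := [set z | 0 <= z.2 <= 1].

Definition covering {R : realType} (z : R * R) : R * R :=
  ((1 + z.2) * sin z.1, (1 + z.2) * cos z.1).

Definition is_lift {R : realType} (f F : R * R -> R * R) :=
  [/\ forall z, strip R z -> strip R (F z),
      {within strip R, continuous F} &
      forall z, strip R z -> covering (F z) = f (covering z)].

Definition boundary_twist {R : realType} (f : R * R -> R * R) :=
  exists F, is_lift f F /\
    forall x : R, (F (x, 0)).1 < x < (F (x, 1)).1.

Definition symmetric_fixed_point {R : realType} (f : R * R -> R * R)
    (z : R * R) :=
  [/\ annulus R z, f z = z & z = refl_I z].

Definition components {T : topologicalType} (A : set T) : set (set T) :=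
  connected_component A @` A.

(* The two lemmas below identify the components quantified over in the theorem. *)

Lemma fix_IA_E (R : realType) :
  fix_IA R = [set z | z.1 = 0 /\ 1 <= `|z.2| <= 2].
Proof.
apply/seteqP; split=> -[x y] /=; rewrite /fix_IA /annulus /enorm /refl_I /=.
  move=> [+ [xN]]; have -> : x = 0.
    have /eqP : x *+ 2 = 0 by rewrite mulr2n -{1}xN addNr.
    by rewrite mulrn_eq0 /= => /eqP.
  by rewrite expr0n add0r sqrtr_sqr.
by move=> [-> ?]; rewrite oppr0 expr0n add0r sqrtr_sqr.
Qed.

Lemma components_fix_IA (R : realType) :
  components (fix_IA R) =
    [set [set z | z.1 = 0 /\ 1 <= z.2 <= 2];
         [set z | z.1 = 0 /\ - 2 <= z.2 <= - 1]] /\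
  [set z : R * R | z.1 = 0 /\ 1 <= z.2 <= 2] <>
    [set z | z.1 = 0 /\ - 2 <= z.2 <= - 1].
Proof.
have conn (a b : R) : connected [set z : R * R | z.1 = 0 /\ a <= z.2 <= b].
  have -> : [set z : R * R | z.1 = 0 /\ a <= z.2 <= b] =
            (fun y : R => (0 : R, y)) @` [set` `[a, b]].
    apply/seteqP; split=> [[x y] /= [-> yab]|z /= [y]].
      by exists y => //; rewrite in_itv.
    by rewrite in_itv /= => yab <-.
  apply: connected_continuous_connected; first exact: segment_connected.
  apply: continuous_subspaceT => y.
  by apply: (@cvg_pair _ _ _ _ (nbhs (0 : R)) (nbhs y));
    [exact: cvg_cst|exact: cvg_id].
have upP (z : R * R) : fix_IA R z -> 0 < z.2 -> z.1 = 0 /\ 1 <= z.2 <= 2.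
  by rewrite fix_IA_E => -[-> +] z0; rewrite gtr0_norm.
have dnP (z : R * R) : fix_IA R z -> z.2 < 0 -> z.1 = 0 /\ - 2 <= z.2 <= - 1.
  by rewrite fix_IA_E => -[-> +] z0; rewrite ltr0_norm // lerNr lerNl andbC.
have up_sub : [set z : R * R | z.1 = 0 /\ 1 <= z.2 <= 2] `<=` fix_IA R.
  move=> z [z0 z12]; rewrite fix_IA_E; split=> //.
  by rewrite gtr0_norm // (lt_le_trans ltr01) //; case/andP: z12.
have dn_sub : [set z : R * R | z.1 = 0 /\ - 2 <= z.2 <= - 1] `<=` fix_IA R.
  move=> z [z0 z12]; rewrite fix_IA_E; split=> //.
  have z2 : z.2 < 0 by case/andP: z12 => _ /le_lt_trans -> //; rewrite oppr_lt0.
  by rewrite ltr0_norm // lerNr lerNl andbC.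
have nz (z : R * R) : fix_IA R z -> z.2 != 0.
  by rewrite fix_IA_E => -[_ +]; apply: contraTneq => ->; rewrite normr0 ler10.
have noz (C : set (R * R)) z w : connected C -> C `<=` fix_IA R -> C z -> C w ->
    z.2 < 0 -> 0 < w.2 -> False.
  move=> Cc CF Cz Cw z0 w0.
  have : connected (snd @` C).
    apply: connected_continuous_connected => //.
    by apply: continuous_subspaceT => ?; exact: cvg_snd.
  move=> /connected_intervalP /(_ z.2 w.2).
  have Iz : (snd @` C) z.2 by exists z.
  have Iw : (snd @` C) w.2 by exists w.
  move=> /(_ Iz Iw 0); rewrite !ltW// => /(_ isT) [v /CF /nz /eqP ? ?] //.
have up_comp z : fix_IA R z -> 0 < z.2 ->
    connected_component (fix_IA R) z = [set z | z.1 = 0 /\ 1 <= z.2 <= 2].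
  move=> Fz z0; apply/seteqP; split=> [w [C [Cz CF Cc] Cw]|]; last first.
    by apply: connected_component_max => //; exact: upP.
  apply: upP; first exact: CF.
  have /CF/nz := Cw; rewrite neq_lt => /orP[w0|//].
  by case: (noz C w z).
have dn_comp z : fix_IA R z -> z.2 < 0 ->
    connected_component (fix_IA R) z = [set z | z.1 = 0 /\ - 2 <= z.2 <= - 1].
  move=> Fz z0; apply/seteqP; split=> [w [C [Cz CF Cc] Cw]|]; last first.
    by apply: connected_component_max => //; exact: dnP.
  apply: dnP; first exact: CF.
  have /CF/nz := Cw; rewrite neq_lt => /orP[//|w0].
  by case: (noz C z w).
have up1 : [set z : R * R | z.1 = 0 /\ 1 <= z.2 <= 2] (0, 1).
  by split=> //=; rewrite lexx ler1n.
have dn1 : [set z : R * R | z.1 = 0 /\ - 2 <= z.2 <= - 1] (0, - 1).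
  by split=> //=; rewrite lexx lerN2 ler1n.
split; last first.
  move=> /seteqP[+ _] => /(_ _ up1) /= [_ /andP[_]].
  by rewrite leNgt (lt_trans _ ltr01) // oppr_lt0.
apply/seteqP; split=> C.
  move=> [z Fz <-]; have := nz _ Fz; rewrite neq_lt => /orP[z0|z0].
    by right; exact: dn_comp.
  by left; exact: up_comp.
move=> [->|->].
  by exists (0, 1); [exact: up_sub|apply: up_comp => //; exact: up_sub].
exists (0, - 1); first exact: dn_sub.
by apply: dn_comp; [exact: dn_sub|rewrite /= oppr_lt0].
Qed.

(* Main.v *)
Require Import Defs.
From mathcomp Require Import all_boot all_order all_algebra.
From mathcomp Require Import all_classical all_reals all_analysis.
From mathcomp Require Import ring lra zify.
Import Order.TTheory GRing.Theory Num.Theory.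
Import numFieldNormedType.Exports.

(* Let [F] be the lift of [f] given by the twist condition. By reversibility
   [J (x, y) = F (- x, y)] satisfies [J o J = T^k] for the deck translation [T],
   and comparing [J o (J o J)] with [(J o J) o J] gives [k = 0], so [J] is an
   involution of the strip; it agrees with [F] on the segment [x = 0]. (The
   segment [x = pi] is handled by the conjugate of [J] by a translation.)
   Suppose that [J] has no fixed point [L t = (0, t)], and put
   [w (s, t) = J (L s) - L t] on the square [0 <= s, t <= 1]. By the twist, [w]
   winds once around the boundary of the square. It does not vanish on the
   diagonal, so this winding number is the difference of the winding numbers of
   [w (s, t)] and [w (t, s)] along the boundary of the triangle [s <= t]. With
   [p = J (L s)] and [q = L t], these two vectors are [p - q] and [J q - J p]. As
   [J] is injective on a convex set, the pair [(p, q)] may be shrunk to antipodal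
   points of a circle, where [J p - J q] is odd; by the oddness of the degree of
   odd maps of the circle the two winding numbers have the same parity, a
   contradiction. *)

Local Open Scope classical_set_scope.
Local Open Scope ring_scope.

(** * Arguments of plane vectors, modulo full turns *)

Definition full_turn {R : realType} (x : R) :=
  exists k : int, x = k%:~R * (2 * pi).

Lemma sin_cosD2piz (R : realType) (x : R) (k : int) :
  sin (x + k%:~R * (2 * pi)) = sin x /\ cos (x + k%:~R * (2 * pi)) = cos x.
Proof.
have pi2 : 2 * pi = pi *+ 2 :> R by rewrite mulr_natl.
have natE (y : R) (n : nat) :
    sin (y + n%:R * (2 * pi)) = sin y /\ cos (y + n%:R * (2 * pi)) = cos y.
  rewrite pi2 mulr_natl.
  by split; [rewrite (periodicn (@sinD2pi R))|rewrite (periodicn (@cosD2pi R))].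
case: k => n; first exact: natE.
rewrite NegzE mulrNz mulNr.
have := natE (x - n.+1%:R * (2 * pi)) n.+1.
by rewrite subrK => -[-> ->].
Qed.

Lemma cos_eq1 (R : realType) (x : R) : cos x = 1 -> full_turn x.
Proof.
move=> cx; have pi0 := @pi_gt0 R.
have pi2 : 0 < 2 * pi :> R by lra.
pose k := Num.floor (x / (2 * pi)); exists k.
have /andP[k1 k2] := Num.Theory.floor_itv (x / (2 * pi)).
rewrite -/k in k1 k2.
move: k1 k2; rewrite ler_pdivlMr // ltr_pdivrMr // intrD => k1 k2.
set y := x - k%:~R * (2 * pi).
have cy : cos y = 1.
  by rewrite -cx -(sin_cosD2piz _ y k).2 /y subrK.
suff : y = 0 by rewrite /y => /subr0_eq.
have [ypi|ypi] := leP y pi.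
  apply: cos_inj; rewrite ?in_itv /= ?cos0 //; last by rewrite lexx ltW.
  by rewrite ypi andbT /y; lra.
have cy' : cos (2 * pi - y) = 1.
  by rewrite -cosN opprB -(sin_cosD2piz _ (y - 2 * pi) 1).2 mul1r subrK.
have : 2 * pi - y = 0.
  apply: cos_inj; rewrite ?in_itv /= ?cos0 //; last by rewrite lexx ltW.
  by apply/andP; split; rewrite /y; [lra|move: ypi; rewrite /y; lra].
move: k2; rewrite /y; lra.
Qed.

(** [a] is an argument of the nonzero vector [v]; a relation, so that no branch has to be chosen. *)
Definition polar {R : realType} (v : R * R) (a : R) :=
  exists2 r : R, 0 < r & v = (r * cos a, r * sin a).

(** With [c = cos (a - b)], projecting the vector on either direction gives [s * c = r] and
    [r * c = s]; positivity forces [c = 1]. *)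
Lemma polar_unique (R : realType) (v : R * R) (a b : R) :
  polar v a -> polar v b -> full_turn (a - b).
Proof.
move=> [r r0 ->] [s s0 [e1 e2]]; apply: cos_eq1; rewrite cosB.
set c := (X in X = _).
have ca := cos2Dsin2 a; have cb := cos2Dsin2 b.
have e3 : s * c = r.
  have -> : s * c = cos a * (s * cos b) + sin a * (s * sin b) by rewrite /c;
    ring.
  by rewrite -e1 -e2 -[RHS]mulr1 -ca; ring.
have e4 : r * c = s.
  have -> : r * c = cos b * (r * cos a) + sin b * (r * sin a) by rewrite /c;
    ring.
  by rewrite e1 e2 -[RHS]mulr1 -cb; ring.
have c1 : c <= 1 by rewrite /c -cosB cos_le1.
nra.
Qed.

Lemma polarDturn (R : realType) (v : R * R) (a b : R) :
  polar v a -> full_turn (a - b) -> polar v b.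
Proof.
move=> [r r0 ->] [k e]; exists r => //.
have -> : a = b + k%:~R * (2 * pi) by rewrite -e; ring.
by have [-> ->] := sin_cosD2piz _ b k.
Qed.

Lemma polarN (R : realType) (v : R * R) (a : R) :
  polar v a -> polar (- v) (a + pi).
Proof.
move=> [r r0 ->]; exists r => //.
by rewrite cosDpi sinDpi !mulrN.
Qed.

Lemma polar_neq0 (R : realType) (v : R * R) (a : R) : polar v a -> v != 0.
Proof.
move=> [r r0 ->]; apply/eqP => -[] e1 e2; have := cos2Dsin2 a.
move: e1 e2 => /eqP; rewrite mulf_eq0 gt_eqF //= => /eqP ->.
move=> /eqP; rewrite mulf_eq0 gt_eqF //= => /eqP ->.
rewrite expr0n /=; lra.
Qed.

Definition dot {R : realType} (v w : R * R) := v.1 * w.1 + v.2 * w.2.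
Definition cross {R : realType} (v w : R * R) := v.1 * w.2 - v.2 * w.1.

(** The quotient is the tangent of the angle from [v] to [w], which is less than a quarter turn; the
    correction is thus continuous in both vectors. *)
Lemma polar_step (R : realType) (v w : R * R) (a : R) :
  polar v a -> 0 < dot v w -> polar w (a + atan (cross v w / dot v w)).
Proof.
move=> [r r0 ->]; case: w => x y; rewrite /dot /cross /= => d0.
have d1 : 0 < x * cos a + y * sin a.
  rewrite -(pmulr_rgt0 _ r0); suff <- : r * cos a * x + r * sin a * y =
    r * (x * cos a + y * sin a) by [].
  by ring.
set b := atan _.
have cb : 0 < cos b by apply: cos_gt0_pihalf; rewrite atan_gtNpi2 atan_ltpi2.
have sb : sin b = cos b * ((y * cos a - x * sin a) / (x * cos a + y * sin a)).
  have : tan b = sin b / cos b by [].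
  rewrite atanK => e; rewrite -[LHS](mulrVK (unitf_gt0 cb)) -e mulrC;
    congr (_ * _).
  field.
  by rewrite ?(gt_eqF d1) ?(gt_eqF d0) ?(gt_eqF r0).
exists ((x * cos a + y * sin a) / cos b); first by rewrite divr_gt0.
have cs := cos2Dsin2 a.
rewrite cosD sinD sb; congr pair.
  transitivity (x * (cos a ^+ 2 + sin a ^+ 2)); first by rewrite cs mulr1.
  by field; rewrite !gt_eqF.
transitivity (y * (cos a ^+ 2 + sin a ^+ 2)); first by rewrite cs mulr1.
by field; rewrite !gt_eqF.
Qed.

Lemma polar_exists (R : realType) (v : R * R) : v != 0 -> exists a, polar v a.
Proof.
move=> v0.
have step u a : polar u a -> 0 < dot u v -> exists b, polar v b.
  by move=> ua uv; eexists; apply: polar_step ua uv.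
have pE : polar (1, 0) (0 : R) by exists 1; rewrite // cos0 sin0 mulr1 mulr0.
have pN : polar (0, 1) (pi / 2 : R).
  by exists 1; rewrite // cos_pihalf sin_pihalf mulr1 mulr0.
have [x0|x0|x0] := ltgtP v.1 0.
- by apply: (step _ _ (polarN _ _ _ pE)); rewrite /dot /=; lra.
- by apply: (step _ _ pE); rewrite /dot /=; lra.
have [y0|y0|y0] := ltgtP v.2 0.
- by apply: (step _ _ (polarN _ _ _ pN)); rewrite /dot /=; lra.
- by apply: (step _ _ pN); rewrite /dot /=; lra.
by move: v0; rewrite [v]surjective_pairing x0 y0 eqxx.
Qed.

(** * Continuous arguments along maps to the punctured plane *)

Lemma itv_IVT (R : realType) (h : R -> R) (a b v : R) : a <= b ->
  (forall x, a <= x <= b -> {for x, continuous h}) ->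
  h a <= v <= h b \/ h b <= v <= h a -> exists2 x, a <= x <= b & h x = v.
Proof.
move=> ab hc hv.
have [||x + <-] := @IVT R h a b v ab; last by rewrite in_itv => ?; exists x.
  apply: continuous_in_subspaceT => x; rewrite inE /= in_itv /=; exact: hc.
by rewrite ge_min le_max; case: hv => /andP[-> ->]; rewrite ?orbT.
Qed.

(** Between two different multiples of [2 * pi], the intermediate value theorem would give a
    half-integer multiple. This is the source of the homotopy invariance used below. *)
Lemma full_turn_const (R : realType) (h : R -> R) (a b : R) : a <= b ->
  (forall x, a <= x <= b -> {for x, continuous h}) ->
  (forall x, a <= x <= b -> full_turn (h x)) -> h a = h b.
Proof.
move=> ab hc ht; have pi0 := @pi_gt0 R.
have [k ka] : full_turn (h a) by apply: ht; rewrite lexx.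
have [l lb] : full_turn (h b) by apply: ht; rewrite lexx andbT.
have nhalf (m : int) :
  ~ exists2 x, a <= x <= b & h x = (m%:~R + 2^-1) * (2 * pi).
  move=> [x /ht[n ->]] /(mulIf _) -/(_ _)/wrap[|e]; first by lra.
  have : (n - m)%:~R * 2%:~R = 1%:~R :> R by rewrite intrD mulrNz e; field.
  rewrite -intrM => /intr_inj; lia.
have [kl|lk|e] := ltgtP k l; last by rewrite ka lb e.
- case: (nhalf k); apply: itv_IVT => //; left; rewrite ka lb.
  have : (k + 1)%:~R <= l%:~R :> R by rewrite ler_int lezD1.
  rewrite intrD => e; apply/andP; split; nra.
- case: (nhalf l); apply: itv_IVT => //; right; rewrite ka lb.
  have : (l + 1)%:~R <= k%:~R :> R by rewrite ler_int lezD1.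
  rewrite intrD => e; apply/andP; split; nra.
Qed.

Lemma cvg_dot (R : realType) (T : Type) (F : set_system T) (FF : Filter F)
    (g h : T -> R * R) (a b : R * R) :
  g @ F --> a -> h @ F --> b -> (fun x => dot (g x) (h x)) @ F --> dot a b.
Proof.
move=> ga hb; rewrite /dot; apply: cvgD; apply: cvgM.
- by apply: cvg_comp ga _; exact: cvg_fst.
- by apply: cvg_comp hb _; exact: cvg_fst.
- by apply: cvg_comp ga _; exact: cvg_snd.
- by apply: cvg_comp hb _; exact: cvg_snd.
Qed.

Lemma cvg_cross (R : realType) (T : Type) (F : set_system T) (FF : Filter F)
    (g h : T -> R * R) (a b : R * R) :
  g @ F --> a -> h @ F --> b -> (fun x => cross (g x) (h x)) @ F --> cross a b.
Proof.
move=> ga hb; rewrite /cross; apply: cvgB; apply: cvgM.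
- by apply: cvg_comp ga _; exact: cvg_fst.
- by apply: cvg_comp hb _; exact: cvg_snd.
- by apply: cvg_comp ga _; exact: cvg_snd.
- by apply: cvg_comp hb _; exact: cvg_fst.
Qed.

Lemma dotvv_gt0 (R : realType) (v : R * R) : v != 0 -> 0 < dot v v.
Proof.
move=> /polar_exists[a [r r0 ->]]; rewrite /dot /=.
have := cos2Dsin2 a; nra.
Qed.

(** The argument of [g x] is reached from a fixed one of [g 0] along the ray [s *: x], in [N.+1]
    steps so short that consecutive vectors have positive dot product. *)
Lemma polar_lift (R : realType) (V : normedModType R) (K : set V)
    (g : V -> R * R) : compact K ->
  (forall (t : R) x, 0 <= t <= 1 -> K x -> K (t *: x)) ->
  (forall x, K x -> {for x, continuous g}) -> (forall x, K x -> g x != 0) ->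
  exists theta : V -> R,
    forall x, K x -> {for x, continuous theta} /\ polar (g x) (theta x).
Proof.
move=> cK starK gc g0.
have [N NP] : exists N : nat, forall x, K x -> forall s : R, 0 <= s <= 1 ->
    0 < dot (g (s *: x)) (g ((s + N.+1%:R^-1) *: x)).
  have cIK : compact (`[(0 : R), 1] `*` K).
    by apply: compact_setX => //; exact: segment_compact.
  (* Compactness makes the step length uniform: as it tends to 0, the dot product near [(s, x)]
     tends to that of [g (s *: x)] with itself, which is positive. *)
  have [|N _ /(_ N (leqnn N)) NP] :=
    iffLR (compact_near_coveringP _) cIK nat \oo
    (fun n z => 0 < dot (g (z.1 *: z.2)) (g ((z.1 + n.+1%:R^-1) *: z.2))) _.
    move=> [s x] [/= s01 Kx].
    have Ksx : K (s *: x) by apply: starK => //; move: s01; rewrite in_itv.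
    suff /cvgr_gt/(_ _ (dotvv_gt0 _ _ (g0 _ Ksx))) :
      (fun z : (R * V) * nat => dot (g (z.1.1 *: z.1.2))
        (g ((z.1.1 + z.2.+1%:R^-1) *:
          z.1.2))) @ filter_prod (nbhs (s, x)) \oo -->
      dot (g (s *: x)) (g (s *: x)) by [].
    pose FF := filter_prod (nbhs (s, x)) \oo.
    have FFF : Filter FF by exact: filter_prod_filter.
    have cf : fst @ FF --> (s, x) by exact: cvg_fst.
    have c1 : (fun z : (R * V) * nat => z.1.1) @ FF --> s.
      exact: (cvg_comp _ _ cf (cvg_fst (F := nbhs s))).
    have c2 : (fun z : (R * V) * nat => z.1.2) @ FF --> x.
      exact: (cvg_comp _ _ cf (cvg_snd (G := nbhs x))).
    have c3 : (fun z : (R * V) * nat => z.2.+1%:R^-1 : R) @ FF --> (0 : R).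
      have cs : snd @ FF --> \oo by exact: cvg_snd.
      exact: (cvg_comp _ _ cs (@cvg_harmonic R)).
    have c4 : (fun z : (R * V) * nat => z.1.1 + z.2.+1%:R^-1) @ FF --> s.
      by rewrite -[X in _ --> X]addr0; exact: cvgD.
    have c5 : (fun z : (R * V) * nat => z.1.1 *: z.1.2) @ FF --> s *: x.
      by apply: cvgZ.
    have c6 : (fun z : (R * V) * nat => (z.1.1 + z.2.+1%:R^-1) *:
      z.1.2) @ FF -->
        s *: x by apply: cvgZ.
    have gsx : g @ (s *: x) --> g (s *: x) by exact: gc.
    by apply: cvg_dot; [exact: (cvg_comp _ _ c5 gsx)|exact:
      (cvg_comp _ _ c6 gsx)].
  exists N => x Kx s s01.
  by apply: (NP (s, x)); split => //=; rewrite in_itv.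
have step m : (m <= N.+1)%N -> exists theta : V -> R, forall x, K x ->
    {for x, continuous theta} /\ polar (g ((m%:R / N.+1%:R) *: x)) (theta x).
  elim: m => [_|m IHm mN].
    (* [g 0 = 0] is only possible for empty [K], since a nonempty [K] contains 0. *)
    have [g00|/polar_exists[a ga]] := eqVneq (g 0) 0.
      exists (fun=> 0) => x Kx.
      suff : K 0 by move=> /g0; rewrite g00 eqxx.
      by rewrite -(scale0r x); apply: starK => //; rewrite lexx ler01.
    exists (fun=> a) => x Kx; split; first exact: cvg_cst.
    by rewrite mul0r scale0r.
  have [theta thetaP] := IHm (ltnW mN).
  pose s : R := m%:R / N.+1%:R; pose t : R := s + N.+1%:R^-1.
  have tE : t = m.+1%:R / N.+1%:R by rewrite /t /s -(natr1 m) mulrDl mul1r.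
  have s01 : 0 <= s <= 1.
    by rewrite divr_ge0 //= ler_pdivrMr // mul1r ler_nat ltnW.
  have t01 : 0 <= t <= 1.
    by rewrite tE divr_ge0 //= ler_pdivrMr // mul1r ler_nat.
  exists (fun x => theta x +
    atan (cross (g (s *: x)) (g (t *: x)) / dot (g (s *: x)) (g (t *: x)))).
  move=> x Kx; have [cx px] := thetaP x Kx; have dx := NP x Kx s s01.
  split; last by rewrite -tE; exact: polar_step.
  have cg u : 0 <= u <= 1 -> (fun x => g (u *: x)) @ x --> g (u *: x).
    move=> u01; have gux : g @ (u *: x) --> g (u *: x) by apply: gc; exact:
      starK.
    by apply: cvg_comp gux; apply: cvgZ; [exact: cvg_cst|exact: cvg_id].
  rewrite /prop_for /continuous_at; apply: cvgD; first exact: cx.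
  apply: continuous_comp; last exact: continuous_atan.
  apply: cvgM; first by apply: cvg_cross; exact: cg.
  apply: cvgV; first by rewrite gt_eqF.
  by apply: cvg_dot; exact: cg.
have [theta thetaP] := step _ (leqnn _); exists theta => x /thetaP.
by rewrite divff // scale1r.
Qed.

Definition angle_lift {R : realType} {T : topologicalType} (K : set T)
    (g : T -> R * R) (theta : T -> R) :=
  forall x, K x -> {for x, continuous theta} /\ polar (g x) (theta x).

Lemma angle_lift_itv (R : realType) (A : R) (g : R -> R * R) : 0 <= A ->
  (forall x, - A <= x <= A -> {for x, continuous g}) ->
  (forall x, - A <= x <= A -> g x != 0) ->
  exists theta, angle_lift [set x | - A <= x <= A] g theta.
Proof.
move=> A0 gc g0; apply: (@polar_lift R R) => //.
  suff -> : [set x : R | - A <= x <= A] = `[- A, A]%classic by exact: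
    segment_compact.
  by apply/seteqP; split=> x /=; rewrite in_itv.
move=> t x /= t01; rewrite -!ler_norml normrM => xA.
by case/andP: t01 => t0 t1; rewrite (ger0_norm t0); apply: le_trans xA;
  rewrite ler_piMl.
Qed.

Lemma angle_lift_square (R : realType) (A : R) (g : R * R -> R * R) : 0 <= A ->
  (forall z, - A <= z.1 <= A -> - A <= z.2 <= A -> {for z, continuous g}) ->
  (forall z, - A <= z.1 <= A -> - A <= z.2 <= A -> g z != 0) ->
  exists theta,
    angle_lift [set z | - A <= z.1 <= A /\ - A <= z.2 <= A] g theta.
Proof.
move=> A0 gc g0; apply: (@polar_lift R (R * R)%type).
- suff -> : [set z : R * R | - A <= z.1 <= A /\ - A <= z.2 <= A] =
      `[- A, A]%classic `*` `[- A, A]%classic by apply: compact_setX; exact: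
        segment_compact.
  by apply/seteqP; split=> x /=; rewrite !in_itv.
- move=> t [x y] /andP[t0 t1] /=; rewrite -!ler_norml !normrM => -[xA yA].
  by split; rewrite (ger0_norm t0);
    [apply: le_trans xA|apply: le_trans yA]; rewrite ler_piMl.
- by move=> z [? ?]; exact: gc.
- by move=> z [? ?]; exact: g0.
Qed.

(** Two lifts differ by full turns, hence by a constant. *)
Lemma angle_lift_unique (R : realType) (g : R -> R * R) (a b : R)
    (theta phi : R -> R) : a <= b ->
  angle_lift [set x | a <= x <= b] g theta ->
  angle_lift [set x | a <= x <= b] g phi ->
  theta b - theta a = phi b - phi a.
Proof.
move=> ab tP pP.
suff : theta a - phi a = theta b - phi b by lra.
apply: (@full_turn_const _ (fun x => theta x - phi x) _ _ ab) => x xab.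
  by apply: cvgB; [exact: (tP x xab).1|exact: (pP x xab).1].
exact: polar_unique (tP x xab).2 (pP x xab).2.
Qed.

(* An odd map of the circle has odd degree [1 + 2 * m]. *)
Lemma odd_angle_lift (R : realType) (h : R -> R * R) (phi : R -> R) (A : R) :
  pi <= A -> (forall x, h (x + pi) = - h x) ->
  angle_lift [set x | - A <= x <= A] h phi ->
  exists m : int, forall (n : int) x, - A <= x <= A ->
    - A <= x + n%:~R * (2 * pi) <= A ->
    phi (x + n%:~R * (2 * pi)) - phi x = n%:~R * (2 * pi) * (1 + 2 * m%:~R).
Proof.
move=> piA hodd phiP; have pi0 := @pi_gt0 R.
(* A half turn of [x] changes [phi] by [pi] up to [m] full turns, with [m] independent of [x];
   larger shifts are sums of half turns. *)
have [m mE] : exists m : int, forall x, - A <= x <= A - pi ->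
    phi (x + pi) - phi x = pi * (1 + 2 * m%:~R).
  have turn x : - A <= x <= A - pi -> full_turn (phi (x + pi) - phi x - pi).
    move=> xA; suff : full_turn (phi (x + pi) - (phi x + pi)).
      by rewrite opprD addrA.
    apply: (@polar_unique _ (h (x + pi))).
      by apply: (phiP _ _).2 => /=; lra.
    by rewrite hodd; apply: polarN; apply: (phiP _ _).2 => /=; lra.
  have [|m mE] := turn (- A); first by lra.
  exists m => x xA.
  suff : phi (- A + pi) - phi (- A) - pi = phi (x + pi) - phi x - pi by lra.
  apply: (@full_turn_const _ (fun x => phi (x + pi) - phi x - pi));
    first by lra.
    move=> y yA; rewrite /prop_for /continuous_at; apply: cvgB; last exact:
      cvg_cst.
    apply: cvgB; last by apply: (phiP _ _).1 => /=; lra.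
    apply: (@continuous_comp _ _ _ (fun y => y + pi)).
      by apply: cvgD; [exact: cvg_id|exact: cvg_cst].
    by apply: (phiP _ _).1 => /=; lra.
  by move=> y yA; apply: turn; lra.
exists m.
have natE (j : nat) x : - A <= x <= A -> x + j%:R * pi <= A ->
    phi (x + j%:R * pi) - phi x = j%:R * pi * (1 + 2 * m%:~R).
  elim: j => [|j IHj] xA jA; first by rewrite !mul0r addr0 subrr.
  have j0 : 0 <= j%:R * pi :> R by rewrite mulr_ge0 // ltW.
  move: jA; rewrite -natr1 mulrDl mul1r addrA => jA.
  have := IHj xA; have := mE (x + j%:R * pi); lra.
case=> j x xA jA.
  have := natE (2 * j)%N x xA; rewrite natrM.
  have -> : 2%:R * j%:R * pi = j%:~R * (2 * pi) :> R by rewrite /=; ring.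
  by apply; lra.
have := natE (2 * j.+1)%N _ jA; rewrite natrM.
rewrite NegzE mulrNz.
have -> : 2%:R * j.+1%:R * pi = j.+1%:~R * (2 * pi) :> R by rewrite /=; ring.
rewrite !mulNr subrK; case/andP: xA => _ xA /(_ xA); lra.
Qed.

(** * Deformation of a pair of points of the strip to antipodal points *)

(** The retraction of the line onto [[0, 1]], in a closed form whose continuity is immediate; it
    turns maps on the interval into total ones. *)
Definition clip {R : realType} (x : R) : R := (`|x| - `|x - 1| + 1) / 2.

Lemma clip_cont (R : realType) : continuous (@clip R).
Proof.
move=> x; apply: cvgM; last exact: cvg_cst.
apply: cvgD; last exact: cvg_cst.
apply: cvgB; apply: cvg_norm; first exact: cvg_id.
by apply: cvgB; [exact: cvg_id|exact: cvg_cst].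
Qed.

Lemma clip_itv (R : realType) (x : R) : 0 <= clip x <= 1.
Proof.
rewrite /clip; have [?|?] := ger0P x; have [?|?] := ger0P (x - 1); lra.
Qed.

Lemma clip_id (R : realType) (x : R) : 0 <= x <= 1 -> clip x = x.
Proof.
rewrite /clip; have [?|?] := ger0P x; have [?|?] := ger0P (x - 1); lra.
Qed.

Lemma clip_le0 (R : realType) (x : R) : x <= 0 -> clip x = 0.
Proof.
rewrite /clip; have [?|?] := ger0P x; have [?|?] := ger0P (x - 1); lra.
Qed.

Lemma clip_ge1 (R : realType) (x : R) : 1 <= x -> clip x = 1.
Proof.
rewrite /clip; have [?|?] := ger0P x; have [?|?] := ger0P (x - 1); lra.
Qed.

(* The homotopy, with parameter [k], from [p] to the point [e * (cos a, sin a)]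
   relative to the midpoint of the strip. *)
Definition to_circle {R : realType} (e : R) (p : R * R) (a k : R) : R * R :=
  ((1 - k) * p.1 + k * (e * cos a), (1 - k) * p.2 + k * (2^-1 + e * sin a)).

Lemma cvg_to_circle (R : realType) (T : Type) (F : set_system T) (FF : Filter F)
    (e : R) (p : T -> R * R) (a k : T -> R) (p0 : R * R) (a0 k0 : R) :
  p @ F --> p0 -> a @ F --> a0 -> k @ F --> k0 ->
  (fun x => to_circle e (p x) (a x) (k x)) @ F --> to_circle e p0 a0 k0.
Proof.
move=> pF aF kF.
have k1F : (fun x => 1 - k x) @ F --> 1 - k0 by apply: cvgB => //; exact:
  cvg_cst.
have cF : (fun x => e * cos (a x)) @ F --> e * cos a0.
  apply: cvgM; first exact: cvg_cst.
  exact: (cvg_comp _ _ aF (@continuous_cos R a0)).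
have sF : (fun x => e * sin (a x)) @ F --> e * sin a0.
  apply: cvgM; first exact: cvg_cst.
  exact: (cvg_comp _ _ aF (@continuous_sin R a0)).
apply: (cvg_pair (G := nbhs _) (H := nbhs _)); apply: cvgD; apply: cvgM => //.
- by apply: cvg_comp pF _; exact: cvg_fst.
- by apply: cvg_comp pF _; exact: cvg_snd.
- by apply: cvgD => //; exact: cvg_cst.
Qed.

(** The strip is convex and contains the circles of radius at most [4^-1] about [(0, 2^-1)]. *)
Lemma to_circle_strip (R : realType) (e : R) (p : R * R) (a k : R) :
  - 4^-1 <= e <= 4^-1 -> 0 <= k <= 1 -> strip R p ->
  strip R (to_circle e p a k).
Proof.
move=> e4 k01; rewrite /strip /= => p01.
have s1 := sin_le1 a; have s2 := sin_geN1 a.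
have : 0 <= 2^-1 + e * sin a <= 1 by nra.
move: (2^-1 + _) => y y01.
have ? : 0 <= (1 - k) * p.2 by rewrite mulr_ge0; lra.
have ? : 0 <= k * y by rewrite mulr_ge0; lra.
have ? : 0 <= (1 - k) * (1 - p.2) by rewrite mulr_ge0; lra.
have ? : 0 <= k * (1 - y) by rewrite mulr_ge0; lra.
lra.
Qed.

(** The angle being that of [p - q], the difference of the two points remains a positive multiple,
    [(1 - k) * r + k / 2], of the same unit vector. *)
Lemma to_circle_neq (R : realType) (p q : R * R) (a k : R) :
  0 <= k <= 1 -> polar (p - q) a ->
  to_circle 4^-1 p a k <> to_circle (- 4^-1) q a k.
Proof.
move=> k01 [r r0 [e1 e2]] [f1 f2].
have : (((1 - k) * r + k * 2^-1) * cos a, ((1 - k) * r + k * 2^-1) * sin a) = 0.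
  congr pair; [transitivity ((1 - k) * (r * cos a) + k * 2^-1 * cos a)
              |transitivity ((1 - k) * (r * sin a) + k * 2^-1 * sin a)];
                try ring.
    by rewrite -e1 /=; lra.
  by rewrite -e2 /=; lra.
apply/eqP; apply: (@polar_neq0 _ _ a); exists ((1 - k) * r + k * 2^-1) => //.
nra.
Qed.

(* The pair [(p, q)] is deformed, without collision, to antipodal points of a
   circle; there [f p - f q] is an odd function of the angle of [p - q]. *)
Lemma loop_angle_change (R : realType) (f : R * R -> R * R) (p q : R -> R * R)
    (T : R) (alpha beta : R -> R) : 1 <= T ->
  continuous f ->
  (forall z w, strip R z -> strip R w -> f z = f w -> z = w) ->
  continuous p -> continuous q ->
  (forall t, strip R (p t)) -> (forall t, strip R (q t)) ->
  p T = p 0 -> q T = q 0 ->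
  angle_lift [set t | - T <= t <= T] (fun t => p t - q t) alpha ->
  angle_lift [set t | - T <= t <= T] (fun t => f (p t) - f (q t)) beta ->
  exists k : int,
    (alpha T - alpha 0) - (beta T - beta 0) = k%:~R * (4 * pi).
Proof.
move=> T1 fc finj pc qc pS qS pT qT alphaP betaP; have pi0 := @pi_gt0 R.
have T0 : 0 <= T by lra.
have [n nE] : full_turn (alpha T - alpha 0).
  apply: (@polar_unique _ (p T - q T)); first by apply: (alphaP _ _).2 => /=;
    lra.
  by rewrite pT qT; apply: (alphaP _ _).2 => /=; lra.
pose e : R := 4^-1.
(* [G] interpolates between [f (p t) - f (q t)] at [k = 0] and [h (alpha t)] at [k = 1]. *)
pose G (z : R * R) := f (to_circle e (p z.1) (alpha z.1) (clip z.2)) -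
                      f (to_circle (- e) (q z.1) (alpha z.1) (clip z.2)).
pose h (a : R) := f (to_circle e 0 a 1) - f (to_circle (- e) 0 a 1).
have eP : - 4^-1 <= e <= 4^-1 by rewrite /e; lra.
have eN : - 4^-1 <= - e <= 4^-1 by rewrite /e; lra.
have [psi psiP] : exists theta,
    angle_lift [set z | - T <= z.1 <= T /\ - T <= z.2 <= T] G theta.
  apply: angle_lift_square => // -[t k] /= tT kT.
    have [ac ap] := alphaP t tT.
    have c1 : fst @ (t, k) --> t by exact: cvg_fst.
    have c2 : snd @ (t, k) --> k by exact: cvg_snd.
    have ca := cvg_comp _ _ c1 ac.
    have ck := cvg_comp _ _ c2 (@clip_cont R k).
    rewrite /prop_for /continuous_at /G /=.
    apply: cvgB; (apply: cvg_comp; last exact: fc); apply: cvg_to_circle => //.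
      exact: (cvg_comp _ _ c1 (pc t)).
    exact: (cvg_comp _ _ c1 (qc t)).
  apply/eqP => /subr0_eq /finj.
  move=> /(_ (to_circle_strip _ _ _ _ _ eP (clip_itv _ k) (pS t))).
  move=> /(_ (to_circle_strip _ _ _ _ _ eN (clip_itv _ k) (qS t))).
  by apply: to_circle_neq; [exact: clip_itv|exact: (alphaP _ _).2].
(* [B] bounds [alpha] on the loop, so that a lift of [h] on [[-B, B]] can be composed with [alpha];
   [odd_angle_lift] asks for [pi <= B]. *)
have [B [BT Bpi alphaB]] : exists B, [/\ 0 <= B, pi <= B &
    forall t, 0 <= t <= T -> - B <= alpha t <= B].
  have [|c _ cP] := @EVT_max R (fun t => `|alpha t|) 0 T T0.
    apply: continuous_in_subspaceT => t; rewrite inE /= in_itv /= => tT.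
    by apply: cvg_norm; apply: (alphaP _ _).1 => /=; lra.
  exists (pi + `|alpha c|); split; first by rewrite addr_ge0 // ltW.
    by rewrite lerDl.
  move=> t tT; rewrite -ler_norml; have := cP t; rewrite in_itv /= => /(_ tT);
    lra.
have zS : strip R 0 by rewrite /strip /= lexx ler01.
have h0 a : h a != 0.
  apply/eqP => /subr0_eq /finj.
  have one01 : 0 <= (1 : R) <= 1 by rewrite lexx ler01.
  move=> /(_ (to_circle_strip _ _ _ _ _ eP one01 zS)).
  move=> /(_ (to_circle_strip _ _ _ _ _ eN one01 zS)).
  rewrite /to_circle !subrr !mul0r !add0r !mul1r => -[e1 e2].
  have := cos2Dsin2 a; have -> : cos a = 0 by rewrite /e in e1; lra.
  have -> : sin a = 0 by rewrite /e in e2; lra.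
  rewrite expr0n /=; lra.
have [phi phiP] : exists phi, angle_lift [set a | - B <= a <= B] h phi.
  apply: angle_lift_itv => // a _; rewrite /prop_for /continuous_at /h.
  apply: cvgB; (apply: cvg_comp; last exact: fc); apply: cvg_to_circle;
    by [exact: cvg_id|exact: cvg_cst].
have hodd a : h (a + pi) = - h a.
  rewrite /h opprB /to_circle cosDpi sinDpi.
  by congr (f _ - f _); congr pair; ring.
have [m mP] := odd_angle_lift _ _ _ _ Bpi hodd phiP.
have alpha0B := alphaB 0 _; have alphaTB := alphaB T _.
have change0 : psi (T, 0) - psi (0, 0) = beta T - beta 0.
  apply: (angle_lift_unique _ (fun t => f (p t) - f (q t))
    _ _ (fun t => psi (t, 0))) => // t /= tT.
    have [|tc tp] := psiP (t, 0); first by split => /=; lra.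
    split; last first.
      move: tp; rewrite /G /to_circle /= clip_le0 // !subr0 !mul1r !mul0r !addr0.
      by rewrite -!surjective_pairing.
    apply: (@continuous_comp _ _ _ (fun t : R => (t, 0 : R))) => //.
    by apply: (cvg_pair (G := nbhs _) (H := nbhs _)); [exact: cvg_id|exact:
      cvg_cst].
  by apply: betaP => /=; lra.
have change1 : psi (T, 1) - psi (0, 1) = phi (alpha T) - phi (alpha 0).
  apply: (angle_lift_unique _ (fun t => h (alpha t))
    _ _ (fun t => psi (t, 1)) (fun t => phi (alpha t))) => // t /= tT.
    have [|tc tp] := psiP (t, 1); first by split => /=; lra.
    split; last first.
      by move: tp; rewrite /G /h /to_circle /= clip_ge1 // !subrr !mul1r !mul0r.
    apply: (@continuous_comp _ _ _ (fun t : R => (t, 1 : R))) => //.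
    by apply: (cvg_pair (G := nbhs _) (H := nbhs _)); [exact: cvg_id|exact:
      cvg_cst].
  have [pc' pp] := phiP _ (alphaB _ tT); split => //.
  by apply: continuous_comp => //; apply: (alphaP _ _).1 => /=; lra.
(* The loop closes up for every [k], as [alpha] changes by full turns; so the angle change is the
   same at both ends of the deformation. *)
have : psi (T, 0) - psi (0, 0) = psi (T, 1) - psi (0, 1).
  apply: (@full_turn_const _ (fun k => psi (T, k) - psi (0, k))) => // k k01.
    have cT t : - T <= t <= T -> {for k, continuous (fun k => psi (t, k))}.
      move=> tT; apply: (@continuous_comp _ _ _ (fun k => (t, k))).
        by apply: (cvg_pair (G := nbhs _) (H := nbhs _)); [exact:
          cvg_cst|exact: cvg_id].
      by apply: (psiP (t, k) _).1; split => /=; lra.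
    by apply: cvgB; apply: cT; lra.
  apply: (@polar_unique _ (G (T, k))).
    by apply: (psiP (T, k) _).2; split => /=; lra.
  have -> : G (T, k) = G (0, k).
    have aE : alpha T = alpha 0 + n%:~R * (2 * pi) by lra.
    have [sE cE] := sin_cosD2piz _ (alpha 0) n.
    by rewrite /G /to_circle /= pT qT aE sE cE.
  by apply: (psiP (0, k) _).2; split => /=; lra.
rewrite change0 change1 nE => ->.
have aE : alpha T = alpha 0 + n%:~R * (2 * pi) by lra.
(* [alpha] makes [n] turns and [beta] makes [n * (1 + 2 * m)]: the difference is an even number of
   turns. *)
exists (- (n * m)); rewrite aE mP ?mulrNz ?intrM.
- ring.
- by apply: alpha0B; lra.
- by rewrite -aE; apply: alphaTB; lra.
Qed.

(** * Winding around the triangle and fixed points of involutions *)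

Lemma angle_lift_from (R : realType) (T : topologicalType) (K : set T)
    (g : T -> R * R) (theta : T -> R) (x0 : T) (a : R) : K x0 ->
  angle_lift K g theta -> polar (g x0) a ->
  exists2 phi, angle_lift K g phi & phi x0 = a.
Proof.
move=> Kx0 thetaP ga; exists (fun x => theta x - (theta x0 - a)); last ring.
move=> x Kx; have [tc tp] := thetaP x Kx; split.
  by apply: cvgB => //; exact: cvg_cst.
apply: polarDturn tp _; rewrite opprB addrC subrK.
exact: polar_unique (thetaP _ Kx0).2 ga.
Qed.

Lemma cos_ge0_near0 (R : realType) (x : R) :
  - pi <= x <= pi -> 0 <= cos x -> - (pi / 2) <= x <= pi / 2.
Proof.
have pi0 := @pi_gt0 R.
have half (y : R) : 0 <= y -> y <= pi -> 0 <= cos y -> y <= pi / 2.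
  move=> y0 ypi cy; rewrite leNgt; apply/negP => yhalf.
  have : 0 < cos (pi - y) by apply: cos_gt0_pihalf; lra.
  by rewrite cosB cospi sinpi; lra.
move=> xpi cx; have [x0|x0] := leP 0 x.
  by have := half x x0; lra.
by have := half (- x); rewrite cosN; lra.
Qed.

(** In the half plane, an angle within [pi] of [c] is within [pi / 2] of it; getting further away
    would require passing [c + pi] or [c - pi]. *)
Lemma half_plane_lift (R : realType) (g : R -> R * R) (theta : R -> R)
    (a b c : R) : a <= b -> angle_lift [set x : R | a <= x <= b] g theta ->
  (forall x, a <= x <= b -> 0 <= dot (cos c, sin c) (g x)) ->
  c - pi <= theta a <= c + pi ->
  c - pi / 2 <= theta b <= c + pi / 2.
Proof.
move=> ab thetaP gc ta; have pi0 := @pi_gt0 R.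
have near0 x : a <= x <= b -> c - pi <= theta x <= c + pi ->
    c - pi / 2 <= theta x <= c + pi / 2.
  move=> xab tx; suff : - (pi / 2) <= theta x - c <= pi / 2 by lra.
  apply: cos_ge0_near0; first by lra.
  have := gc x xab; have [r r0 ->] := (thetaP x xab).2.
  rewrite /dot /= cosB => d0; rewrite -(pmulr_rge0 _ r0).
  by apply: le_trans d0 _; rewrite le_eqVlt; apply/orP; left; apply/eqP; ring.
have tc x : a <= x <= b -> {for x, continuous theta} by move=> /thetaP[].
have ta' : c - pi / 2 <= theta a <= c + pi / 2 by apply: near0; lra.
have [tb|tb] := leP (theta b) (c + pi); last first.
  have [x xab xv] : exists2 x, a <= x <= b & theta x = c + pi.
    by apply: itv_IVT => //; left; lra.
  by have := near0 x xab; rewrite xv; lra.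
have [tb'|tb'] := leP (c - pi) (theta b); first by apply: near0; lra.
have [x xab xv] : exists2 x, a <= x <= b & theta x = c - pi.
  by apply: itv_IVT => //; right; lra.
by have := near0 x xab; rewrite xv; lra.
Qed.

Lemma involution_fixed_point (R : realType) (J : R * R -> R * R) :
  continuous J -> (forall z, strip R z -> strip R (J z)) ->
  (forall z, strip R z -> J (J z) = z) ->
  (J (0, 0)).1 < 0 < (J (0, 1)).1 ->
  exists2 y : R, 0 <= y <= 1 & J (0, y) = (0, y).
Proof.
move=> Jc JS JK /andP[J0 J1]; apply: contrapT => nofix.
have pi0 := @pi_gt0 R.
have Jinj z w : strip R z -> strip R w -> J z = J w -> z = w.
  by move=> zS wS e; rewrite -(JK z zS) e JK.
(* The loop [(s, t)] runs around the triangle [0 <= s <= t <= 1]. *)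
pose s (x : R) := clip (x - 1) - clip (x - 2).
pose t (x : R) := clip x - clip (x - 2).
have clipDc (c : R) : continuous (fun x : R => clip (x - c)).
  move=> x; apply: (@continuous_comp _ _ _ (fun x => x - c)); last exact:
    clip_cont.
  by apply: cvgB; [exact: cvg_id|exact: cvg_cst].
have sc : continuous s by move=> x; apply: cvgB; exact: clipDc.
have tc : continuous t by move=> x; apply: cvgB; [exact: clip_cont|exact:
  clipDc].
have st1 x : x <= 1 -> s x = 0 /\ t x = clip x.
  by move=> x1;
    rewrite /s /t (clip_le0 _ (x - 1)) ?(clip_le0 _ (x - 2)) ?subr0 ?subr0 //;
      lra.
have st2 x : 1 <= x <= 2 -> s x = clip (x - 1) /\ t x = 1.
  by move=> x1;
    rewrite /s /t (clip_ge1 _ x) ?(clip_le0 _ (x - 2)) ?subr0 ?subr0 //; lra.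
have st3 x : 2 <= x -> s x = t x.
  by move=> x2; rewrite /s /t (clip_ge1 _ x) ?(clip_ge1 _ (x - 1)) //; lra.
have [s0 t0] : s 0 = 0 /\ t 0 = 0.
  by have [|-> ->] := st1 0; [exact: ler01|rewrite clip_le0].
have t3 : t 3 = 0 by rewrite /t !clip_ge1 ?subrr //; lra.
have s3 : s 3 = 0 by rewrite st3 //; lra.
have st01 x : 0 <= s x <= 1 /\ 0 <= t x <= 1.
  have [x1|x1] := leP x 1; first by have [-> ->] := st1 x x1;
    rewrite clip_itv lexx ler01.
  have [x2|x2] := leP x 2.
    by have [|-> ->] := st2 x; [lra|rewrite clip_itv lexx ler01].
  have := clip_itv _ (x - 2).
  by rewrite st3 ?(ltW x2) // /t (clip_ge1 _ x); lra.
have lineS y : 0 <= y <= 1 -> strip R (0, y) by [].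
pose p x := J (0, s x); pose q x : R * R := (0, t x).
have linec (u : R -> R) : continuous u -> continuous (fun x => (0 : R, u x)).
  move=> uc x; apply: (cvg_pair (G := nbhs _) (H := nbhs _)); first exact:
    cvg_cst.
  exact: uc.
have qc : continuous q by exact: linec.
have pc : continuous p.
  by move=> x; apply: continuous_comp; [exact: (linec s)|exact: Jc].
have qS x : strip R (q x) by apply: lineS; exact: (st01 x).2.
have pS x : strip R (p x) by apply: JS; apply: lineS; exact: (st01 x).1.
have Jp x : J (p x) = (0, s x) by rewrite /p JK //; apply: lineS; exact:
  (st01 x).1.
(* The side [s = 0] is excluded by the twist at the bottom, [t = 1] by the twist at the top after
   applying [J], and [s = t] by the absence of fixed points. *)
have pq x : p x != q x.
  apply/eqP => e; have [x1|x1] := leP x 1.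
    by move: e; rewrite /p /q; have [-> _] := st1 x x1 => e; move: J0;
      rewrite e /= ltxx.
  have [x2|x2] := leP x 2.
    have := Jp x; rewrite e /q; have [|_ ->] := st2 x; first by lra.
    by move=> e'; move: J1; rewrite e' /= ltxx.
  apply: nofix; exists (t x); first exact: (st01 x).2.
  by rewrite -[in LHS](st3 x (ltW x2)); exact: e.
(* With this order of the terms, [w] equals [v] wherever [s = t], because [J] is an involution. *)
pose v x := p x - q x; pose w x := J (q x) - J (p x).
have vc : continuous v by move=> x; apply: cvgB; [exact: pc|exact: qc].
have Jqc : continuous (J \o q) by move=> x; apply: continuous_comp; [exact:
  qc|exact: Jc].
have Jpc : continuous (J \o p) by move=> x; apply: continuous_comp; [exact:
  pc|exact: Jc].
have wc : continuous w by move=> x; apply: cvgB; [exact: Jqc|exact: Jpc].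
have v0 x : v x != 0 by rewrite subr_eq0.
have w0 x : w x != 0.
  by rewrite subr_eq0; apply: contra_neq (pq x) => /Jinj ->.
have vw0 : w 0 = v 0.
  by rewrite /w Jp /v /p /q s0 t0.
have c30 : (0 : R) <= 3 by lra.
have [al0 al0P] := angle_lift_itv _ _ v c30 (fun x _ => vc x) (fun x _ => v0 x).
have [be0 be0P] := angle_lift_itv _ _ w c30 (fun x _ => wc x) (fun x _ => w0 x).
have in0 : - 3 <= (0 : R) <= 3 by lra.
have v01 : (v 0).1 < 0 by rewrite /v /p /q /= s0 subr0.
(* [v 0] points to the left, so it has an argument within a quarter turn of [pi]; both lifts start
   from it. *)
have [a av aI] : exists2 a, polar (v 0) a & pi / 2 <= a <= 3 * pi / 2.
  have pW : polar (- 1, 0) (pi : R).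
    by exists 1; rewrite // cospi sinpi mulr0 mulrN1.
  exists (pi + atan (cross (- 1, 0) (v 0) / dot (- 1, 0) (v 0))).
    by apply: polar_step => //; move: (v 0) v01 => [x y]; rewrite /dot /=; lra.
  set u := (X in atan X); have := atan_gtNpi2 u; have := atan_ltpi2 u; lra.
have [al alP al_0] := angle_lift_from _ _ _ _ _ 0 a in0 al0P av.
have [be beP be_0] : exists2 be : R -> R,
    angle_lift [set x : R | - 3 <= x <= 3] w be & be 0 = a.
  by apply: angle_lift_from be0P _; rewrite ?vw0.
have sub (x1 x2 : R) (g : R -> R * R) (th : R -> R) : - 3 <= x1 -> x2 <= 3 ->
    angle_lift [set x : R | - 3 <= x <= 3] g th ->
    angle_lift [set x : R | x1 <= x <= x2] g th.
  by move=> h1 h2 thP x /= xI; apply: thP => /=; lra.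
(* [loop_angle_change] concerns [J p - J q], which is [- w]; hence the lift [be + pi]. *)
have [k kE] : exists k : int, (al 3 - al 0) - (be 3 - be 0) = k%:~R * (4 * pi).
  have := loop_angle_change _ J p q 3 al (fun x =>
    be x + pi) _ Jc Jinj pc qc pS qS.
  case=> //; first by lra.
  - by rewrite /p s0 s3.
  - by rewrite /q t0 t3.
  - move=> x xI; split.
      by apply: cvgD; [exact: (beP x xI).1|exact: cvg_cst].
    by rewrite -opprB; apply: polarN; exact: (beP x xI).2.
  by move=> k kE; exists k; rewrite -kE; ring.
(* On the side [s = 0], [v] points to the left; on [t = 1] it points weakly downwards, [q] being on
   the top edge. *)
have al1 : pi - pi / 2 <= al 1 <= pi + pi / 2.
  apply: (half_plane_lift _ v _ 0) => //; first by apply: sub alP; lra.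
    move=> x xI; rewrite cospi sinpi /dot /v /p /q /=.
    by have [|-> _] := st1 x; lra.
  lra.
have al2 : 3 * pi / 2 - pi / 2 <= al 2 <= 3 * pi / 2 + pi / 2.
  apply: (half_plane_lift _ v _ 1); first by lra.
  - by apply: sub alP; lra.
  - have e : 3 * pi / 2 = pi / 2 + pi :> R by lra.
    move=> x xI; rewrite e cosDpi sinDpi cos_pihalf sin_pihalf /dot /v /q /=.
    have [|_ ->] := st2 x; first by lra.
    have := pS x; rewrite /strip /=; lra.
  lra.
(* On the same two sides, [w] points weakly upwards, since [J p] is at the origin, and then to the
   right, since [J q = J (0, 1)]. *)
have be1 : pi / 2 - pi / 2 <= be 1 <= pi / 2 + pi / 2.
  apply: (half_plane_lift _ w _ 0) => //; first by apply: sub beP; lra.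
    move=> x xI; rewrite /w Jp cos_pihalf sin_pihalf /dot /=.
    have [|-> _] := st1 x; first by lra.
    have := JS _ (qS x); rewrite /strip /=; lra.
  lra.
have be2 : 0 - pi / 2 <= be 2 <= 0 + pi / 2.
  apply: (half_plane_lift _ w _ 1); first by lra.
  - by apply: sub beP; lra.
  - move=> x xI; rewrite /w Jp cos0 sin0 /dot /q /=.
    have [|_ ->] := st2 x; lra.
  lra.
have e23 : al 3 - al 2 = be 3 - be 2.
  apply: (angle_lift_unique _ v); first by lra.
    by apply: sub alP; lra.
  move=> x /= xI; have [|bc bp] := beP x; first by move=> /=; lra.
  split => //; move: bp; rewrite /w Jp /v /p /q st3 //; lra.
(* The lifts have a common start and a common change on the last side, so [kE] expresses
   [al 2 - be 2], which is between [pi / 2] and [5 / 2 * pi]; no multiple of [4 * pi] is. *)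
have k4 : 2^-1 * pi <= k%:~R * (4 * (pi : R)) <= 5 / 2 * pi by lra.
have k0 : 0 < k by rewrite -(ltr_int R); nra.
have : 1 <= k%:~R :> R by rewrite (ler_int R 1) -gtz0_ge1.
nra.
Qed.

(** * The covering of the annulus and lifts of reversible maps *)

Lemma within_comp_continuous (T U V : topologicalType) (A : set U)
    (r : T -> U) (g : U -> V) : {within A, continuous g} -> continuous r ->
  (forall x, A (r x)) -> continuous (g \o r).
Proof.
move=> /subspace_continuousP gc rc rA x; apply: cvg_comp (gc _ (rA x)) => B.
by move=> /(rc x); apply: (@filterS _ (nbhs x)) => y; apply; exact: rA.
Qed.

Lemma continuous_pair (R : realType) (T : topologicalType) (a b : T -> R) :
  continuous a -> continuous b -> continuous (fun x => (a x, b x)).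
Proof.
move=> ac bc x; apply: (cvg_pair (G := nbhs _) (H := nbhs _)).
  exact: ac.
exact: bc.
Qed.

Lemma full_turn_const_strip (R : realType) (D : R * R -> R) : continuous D ->
  (forall z, strip R z -> full_turn (D z)) ->
  forall z w, strip R z -> strip R w -> D z = D w.
Proof.
move=> Dc Dt z w; rewrite /strip /= => zS wS.
pose g (t : R) := (z.1 + t * (w.1 - z.1), z.2 + t * (w.2 - z.2)).
have -> : z = g 0 by rewrite /g !mul0r !addr0 -surjective_pairing.
have -> : w = g 1 by rewrite /g !mul1r !subrKC -surjective_pairing.
apply: (@full_turn_const _ (D \o g)) => // [t _|t t01].
  apply: continuous_comp; last exact: Dc.
  apply: continuous_pair => {}t; (apply: cvgD; first exact: cvg_cst);
    by apply: cvgM; [exact: cvg_id|exact: cvg_cst].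
by apply: Dt; rewrite /strip /=; nra.
Qed.

Lemma covering_inj (R : realType) (z w : R * R) :
  strip R z -> strip R w -> covering z = covering w ->
  z.2 = w.2 /\ full_turn (z.1 - w.1).
Proof.
rewrite /strip /covering /= => zS wS [e1 e2].
(* [covering] lists the sine first; swapping the coordinates puts its value in polar form. *)
have pz : polar ((1 + z.2) * cos z.1, (1 + z.2) * sin z.1) z.1.
  by exists (1 + z.2) => //; lra.
have pw : polar ((1 + z.2) * cos z.1, (1 + z.2) * sin z.1) w.1.
  by rewrite e1 e2; exists (1 + w.2) => //; lra.
have [k kE] := polar_unique _ _ _ _ pz pw; split; last by exists k.
have zE : z.1 = w.1 + k%:~R * (2 * pi) by lra.
have [sE cE] := sin_cosD2piz _ w.1 k; rewrite -zE in sE cE.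
move: e1 e2; rewrite sE cE => e1 e2; have := cos2Dsin2 w.1 => cs.
transitivity ((1 + z.2) * (cos w.1 ^+ 2 + sin w.1 ^+ 2) - 1).
  by rewrite cs; ring.
rewrite mulrDr !expr2 !mulrA e1 e2 -!mulrA -mulrDr -!expr2 cs; ring.
Qed.

Lemma enorm_covering (R : realType) (z : R * R) : strip R z ->
  enorm (covering z) = 1 + z.2.
Proof.
rewrite /strip /enorm /covering /= => zS.
rewrite !exprMn -mulrDr [X in _ * X]addrC cos2Dsin2 mulr1.
by rewrite sqrtr_sqr ger0_norm //; lra.
Qed.

Lemma covering_annulus (R : realType) (z : R * R) :
  strip R z -> annulus R (covering z).
Proof. by move=> zS; rewrite /annulus /= enorm_covering //; move: zS;
  rewrite /strip /=; lra. Qed.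

(** The line [x = m * pi] of the strip lies over the axis of the reflection: over its upper half for
    even [m], its lower half for odd [m]. *)
Lemma lift_fixed_point (R : realType) (f F : R * R -> R * R) (m : int) :
  reversible f -> is_lift f F ->
  (forall x : R, (F (x, 0)).1 < x < (F (x, 1)).1) ->
  exists2 y : R, 0 < y < 1 & F (m%:~R * pi, y) = (m%:~R * pi, y).
Proof.
move=> [f' [[[fA f'A] fK f'K _ _] fI]] [FS Fc Fcov] twist.
have pi0 := @pi_gt0 R.
pose G (z : R * R) := F (z.1, clip z.2).
have fstc : continuous (@fst R R) by move=> ?; exact: cvg_fst.
have sndc : continuous (@snd R R) by move=> ?; exact: cvg_snd.
have compc (h g : R * R -> R * R) :
    continuous h -> continuous g -> continuous (fun z => g (h z)).
  by move=> hc gc z; apply: continuous_comp; [exact: hc|exact: gc].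
have fst_compc (h : R * R -> R * R) :
    continuous h -> continuous (fun z => (h z).1).
  by move=> hc z; apply: continuous_comp; [exact: hc|exact: fstc].
have snd_compc (h : R * R -> R * R) :
    continuous h -> continuous (fun z => (h z).2).
  by move=> hc z; apply: continuous_comp; [exact: hc|exact: sndc].
have Gc : continuous G.
  apply: (within_comp_continuous _ _ _ (strip R) (fun z =>
    (z.1, clip z.2)) F) => //.
    apply: continuous_pair => // z; apply: continuous_comp; first exact: sndc.
    exact: clip_cont.
  by move=> z; exact: clip_itv.
have GE z : strip R z -> G z = F z.
  by move=> zS; rewrite /G clip_id // -surjective_pairing.
have GS z : strip R (G z) by apply: FS; exact: clip_itv.
have shiftc (b : R) : continuous (fun z : R * R => (z.1 + b, z.2)).
  apply: continuous_pair => // z; apply: cvgD; [exact: fstc|exact: cvg_cst].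
(* [d] is the degree of [f], constant because the strip is connected. *)
have [d Gshift1] : exists d : int, forall x y, 0 <= y <= 1 ->
    G (x + 2 * pi, y) = ((G (x, y)).1 + d%:~R * (2 * pi), (G (x, y)).2).
  have inj z : strip R z -> (G (z.1 + 2 * pi, z.2)).2 = (G z).2 /\
      full_turn ((G (z.1 + 2 * pi, z.2)).1 - (G z).1).
    move=> zS; apply: covering_inj => //.
    have zS' : strip R (z.1 + 2 * pi, z.2) by [].
    rewrite !GE // !Fcov // /covering /=.
    by have [] := sin_cosD2piz _ z.1 1; rewrite mul1r => -> ->.
  have zS : strip R 0 by rewrite /strip /= lexx ler01.
  have [_ [d dE]] := inj 0 zS; exists d => x y yS.
  have [<- _] := inj (x, y) yS.
  rewrite -dE [LHS]surjective_pairing; congr pair.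
  suff : (G (x + 2 * pi, y)).1 - (G (x, y)).1 = (G (0 + 2 * pi, 0)).1 - (G 0).1.
    by move=> <-; rewrite subrKC.
  apply: (full_turn_const_strip _
    (fun z => (G (z.1 + 2 * pi, z.2)).1 - (G z).1) _ _ (x, y) 0) => //.
    move=> z; apply: cvgB; last exact: (fst_compc G).
    exact: (fst_compc _ (compc _ _ (shiftc _) Gc)).
  by move=> z /inj[].
have Gshiftn (n : nat) x y : 0 <= y <= 1 -> G (x + n%:R * (2 * pi), y) =
    ((G (x, y)).1 + n%:R * d%:~R * (2 * pi), (G (x, y)).2).
  move=> yS; elim: n => [|n IHn].
    by rewrite !mul0r !addr0 -surjective_pairing.
  rewrite -natr1 mulrDl mul1r addrA Gshift1 // IHn /=; congr pair; ring.
(* Otherwise each deck translation would change the displacement on the bottom edge by the same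
   nonzero multiple of [2 * pi], making it positive far out on one side, against the twist. *)
have d1 : d = 1.
  apply/eqP; rewrite -subr_eq0; apply/negP => /negP d0.
  have y0 : 0 <= (0 : R) <= 1 by rewrite lexx ler01.
  have up (n : nat) : (G (0, 0)).1 + n%:R * (d - 1)%:~R * (2 * pi) < 0.
    have := twist (0 + n%:R * (2 * pi)) => /andP[+ _].
    rewrite -GE // Gshiftn //= intrB; nra.
  have dn (n : nat) : (G (0, 0)).1 - n%:R * (d - 1)%:~R * (2 * pi) < 0.
    have := twist (- (n%:R * (2 * pi))) => /andP[+ _].
    have := Gshiftn n (- (n%:R * (2 * pi))) 0 y0; rewrite addNr => ->.
    rewrite -GE //= intrB; nra.
  pose n := (Num.trunc `|(G (0, 0)).1|).+1.
  have nP : `|(G (0, 0)).1| < n%:R by rewrite truncnS_gt.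
  have pi2 := @pi_ge2 R.
  have large (c D : R) : - n%:R < c -> 1 <= D -> 0 < c + n%:R * D * (2 * pi).
    move=> nc D1; have n0 : 0 <= n%:R :> R by [].
    have nD : n%:R <= n%:R * D by rewrite ler_peMr.
    have : n%:R * D <= n%:R * D * (2 * pi) by rewrite ler_peMr; lra.
    lra.
  have := up n; have := dn n; move: nP; rewrite ltr_norml => /andP[nP _].
  have [d1|d1|e] := ltgtP (d - 1) 0; last by move: d0; rewrite e eqxx.
    have : 1 <= - (d - 1)%:~R :> R by rewrite -mulrNz (ler_int R 1); lia.
    by move=> /(large _ _ nP); lra.
  have : 1 <= (d - 1)%:~R :> R by rewrite (ler_int R 1); lia.
  by move=> /(large _ _ nP); lra.
have Gshift (n : int) x y : 0 <= y <= 1 -> G (x + n%:~R * (2 * pi), y) =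
    ((G (x, y)).1 + n%:~R * (2 * pi), (G (x, y)).2).
  move=> yS; case: n => n; first by rewrite Gshiftn // d1 mulr1.
  have := Gshiftn n.+1 (x - n.+1%:R * (2 * pi)) y yS.
  by rewrite subrK d1 mulr1 NegzE mulrNz mulNr => ->;
    rewrite addrK -surjective_pairing.
(* By reversibility, [J] lifts the involution [f \o refl_I] of the annulus. *)
pose J (z : R * R) := G (- z.1, z.2).
have Jc : continuous J.
  apply: (compc (fun z => (- z.1, z.2)) G) => //.
  by apply: continuous_pair => // z; apply: cvgN; exact: fstc.
have JS z : strip R (J z) by exact: GS.
have Jshift (n : int) (z : R * R) : strip R z ->
  J (z.1 + n%:~R * (2 * pi), z.2) =
    ((J z).1 - n%:~R * (2 * pi), (J z).2).
  move=> zS; have := Gshift (- n) (- z.1) z.2 zS.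
  by rewrite mulrNz mulNr -opprD.
have fIf w : annulus R w -> f (refl_I (f w)) = refl_I w.
  by move=> wA; rewrite fI ?fK //; exact: fA.
have Jcov z : strip R z -> covering (J z) = f (refl_I (covering z)).
  move=> zS; rewrite /J GE // Fcov // /refl_I /covering /=.
  by rewrite sinN cosN mulrN.
have JJ z : strip R z -> (J (J z)).2 = z.2 /\ full_turn ((J (J z)).1 - z.1).
  move=> zS; apply: covering_inj => //.
  rewrite !Jcov //; have zA := covering_annulus _ _ zS.
  rewrite fIf; first by rewrite /refl_I /= opprK.
  by move: zA; rewrite /annulus /enorm /= sqrrN.
have JK z : strip R z -> J (J z) = z.
  move=> zS; have [e2 [k kE]] := JJ z zS.
  (* [J \o J] translates [z] and [J z] by the same amount; as [J] reverses translations, computing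
     [J (J (J z))] in two ways shows this amount to be its own opposite. *)
  have kE' : (J (J (J z))).1 - (J z).1 = k%:~R * (2 * pi).
    rewrite -kE; apply: (full_turn_const_strip _
      (fun z => (J (J z)).1 - z.1) _ _ (J z) z) => //; last by move=> w /JJ[].
    move=> w; apply: cvgB; last exact: fstc.
    exact: (fst_compc _ (compc _ _ Jc Jc)).
  have JJE : J (J z) = (z.1 + k%:~R * (2 * pi), z.2).
    by rewrite -kE subrKC -e2 -surjective_pairing.
  move: kE'; rewrite JJE Jshift //= => kE'.
  have -> : k%:~R * (2 * pi) = 0 :> R by lra.
  by rewrite addr0 -surjective_pairing.
pose b : R := m%:~R * pi.
have bE : b + b = m%:~R * (2 * pi) by rewrite /b; ring.
(* [b] is added both before and after because [J] reverses translations; on [x = 0] the result is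
   [F] on the line [x = b], moved back by [b]. *)
pose Jb (z : R * R) := ((J (z.1 + b, z.2)).1 + b, (J (z.1 + b, z.2)).2).
have JbE y : 0 <= y <= 1 -> Jb (0, y) = ((F (b, y)).1 - b, (F (b, y)).2).
  move=> yS; have := Gshift m (- b) y yS; rewrite -bE addKr -GE // => ->.
  by rewrite /Jb /J /= add0r; congr pair; ring.
have [||||y yS] := involution_fixed_point _ Jb.
- apply: continuous_pair => z.
    apply: cvgD; last exact: cvg_cst.
    exact: (fst_compc _ (compc _ _ (shiftc _) Jc)).
  exact: (snd_compc _ (compc _ _ (shiftc _) Jc)).
- by move=> z _; have := JS (z.1 + b, z.2).
- move=> z zS; rewrite /Jb /= -addrA bE Jshift //.
  by rewrite JK //= -bE; rewrite [RHS]surjective_pairing; congr pair; ring.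
- rewrite !JbE ?lexx ?ler01 //=; have := twist b; lra.
rewrite JbE // => -[e1 e2].
have e : F (b, y) = (b, y) by rewrite [LHS]surjective_pairing e2; congr pair;
  lra.
exists y => //; case/andP: yS => y0 y1; have tb := twist b.
(* The twist excludes fixed points on the boundary lines. *)
have yn0 : y != 0 by apply/eqP => yE; move: tb e; rewrite yE => + e;
  rewrite e /=; lra.
have yn1 : y != 1 by apply/eqP => yE; move: tb e; rewrite yE => + e;
  rewrite e /=; lra.
by rewrite !lt_neqAle y0 y1 eq_sym yn0 yn1.
Qed.

Theorem theorem1p4 (R : realType) (f : R * R -> R * R)
    (f_reversible : reversible f)
    (f_isotopic : isotopic R (annulus R) id f)
    (f_twist : boundary_twist f)
    (C : set (R * R)) (C_component : components (fix_IA R) C) :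
  exists z : R * R,
    [/\ C z, symmetric_fixed_point f z & open_annulus R z].
Proof.
have [F [Flift twist]] := f_twist; have [_ _ Fcov] := Flift.
have fixed (m : int) (s : R) : sin (m%:~R * pi) = 0 :> R ->
    cos (m%:~R * pi) = s :> R -> (forall y, 0 < y < 1 -> C (0, (1 + y) * s)) ->
    exists z : R * R, [/\ C z, symmetric_fixed_point f z & open_annulus R z].
  move=> sm cm Cs.
  have [y y01 Fy] := lift_fixed_point _ _ _ m f_reversible Flift twist.
  have yS : strip R (m%:~R * pi, y) by rewrite /strip /=; lra.
  have zE : covering (m%:~R * pi, y) = (0, (1 + y) * s) :> R * R.
    by rewrite /covering /= sm cm mulr0.
  exists (0, (1 + y) * s); split; first exact: Cs.
    split; last by rewrite /refl_I /= oppr0.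
      by rewrite -zE; exact: covering_annulus.
    by rewrite -zE -Fcov // Fy.
  by rewrite -zE /open_annulus /= enorm_covering //=; lra.
(* [m = 0] serves the upper component, [m = 1] the lower one. *)
move: C_component; rewrite (components_fix_IA R).1 => -[|] CE.
  apply: (fixed 0 1); rewrite ?mul0r ?sin0 ?cos0 // CE => y y01 /=; lra.
apply: (fixed 1 (- 1)); rewrite ?mul1r ?sinpi ?cospi // CE => y y01 /=; lra.
Qed.
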